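(* Fluted logic $\mathrm{FL}$ and $\mathrm{GRA}(\neg,\dot\cap,\exists)$ are equiexpressive; that is, every formula of $\mathrm{FL}$ has an equivalent term of $\mathrm{GRA}(\neg,\dot\cap,\exists)$, and every term of $\mathrm{GRA}(\neg,\dot\cap,\exists)$ has an equivalent formula of $\mathrm{FL}$.
   Context: AD-relations. $A^0=\{\epsilon\}$, with $\epsilon$ the empty tuple. A $k$-ary AD-relation over a set $A$ is a pair $(R,k)$ with $R\subseteq A^k$, $k\ge 0$; $t\in(R,k)$ means $t\in R$. Vocabularies contain only relation symbols (of any arity $k\ge 0$). Models have nonempty domains; $A$ is the domain of $\mathfrak{A}$. Terms. $\mathrm{GRA}(\neg,\dot\cap,\exists)$ is the set of terms built from relation symbols by the unary operators $\neg,\exists$ and the binary operator $\dot\cap$. Each term $\mathcal{T}$ defines in each model $\mathfrak{A}$ an AD-relation $\mathcal{T}^{\mathfrak{A}}$ of arity $\mathit{ar}(\mathcal{T})$. Let $k=\mathit{ar}(\mathcal{T})$, $\ell=\mathit{ar}(\mathcal{S})$, $m=\max\{k,\ell\}$. - $R^{\mathfrak{A}}$ is the interpretation of $R$, paired with the arity of $R$. - $(\neg\mathcal{T})^{\mathfrak{A}}=(\{t\in A^k\mid t\notin\mathcal{T}^{\mathfrak{A}}\},k)$. - Suffix intersection: $(\mathcal{T}\,\dot\cap\,\mathcal{S})^{\mathfrak{A}}=(\{(a_1,\dots,a_m)\in A^m\mid(a_{m-k+1},\dots,a_m)\in\mathcal{T}^{\mathfrak{A}}\text{ and }(a_{m-\ell+1},\dots,a_m)\in\mathcal{S}^{\mathfrak{A}}\},m)$,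 where $(a_{m+1},a_m)$ denotes $\epsilon$. - If $k\ge1$: $(\exists\mathcal{T})^{\mathfrak{A}}=(\{(a_1,\dots,a_{k-1})\mid(a_1,\dots,a_k)\in\mathcal{T}^{\mathfrak{A}}\text{ for some }a_k\in A\},k-1)$; if $k=0$: $(\exists\mathcal{T})^{\mathfrak{A}}=\mathcal{T}^{\mathfrak{A}}$. Fluted logic. Fix the sequence of variables $(v_1,v_2,\dots)$. The sets $\mathrm{FL}^k$, $k\in\mathbb{N}$, are defined by: (1) if $R$ is an $n$-ary relation symbol and $(v_{k-n+1},\dots,v_k)$ is the subsequence of $(v_1,v_2,\dots)$ containing precisely $n$ variables, then $R(v_{k-n+1},\dots,v_k)\in\mathrm{FL}^k$ (for $n=0$ this is the formula $R$); (2) if $\varphi,\psi\in\mathrm{FL}^k$, then $\neg\varphi,(\varphi\wedge\psi)\in\mathrm{FL}^k$; (3) if $\varphi\in\mathrm{FL}^{k+1}$, then $\exists v_{k+1}\varphi\in\mathrm{FL}^k$. Then $\mathrm{FL}=\bigcup_k\mathrm{FL}^k$. Equivalence. A formula $\varphi$ whose free variables are exactly $v_{i_1},\dots,v_{i_k}$ with $i_1<\dots<i_k$ defines $\varphi^{\mathfrak{A}}=(\{(a_1,\dots,a_k)\in A^k\mid\mathfrak{A}\models\varphi(a_1,\dots,a_k)\},k)$, where $a_j$ is assigned to $v_{i_j}$. A formula $\varphi$ and a term $\mathcal{T}$ are equivalent if $\varphi^{\mathfrak{A}}=\mathcal{T}^{\mathfrak{A}}$ for every model $\mathfrak{A}$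 whose vocabulary contains all symbols of $\varphi$ and $\mathcal{T}$. *)

(* Defs.v *)
From mathcomp Require Import all_boot.
From mathcomp Require Import classical_sets.

Set Implicit Arguments.
Unset Strict Implicit.
Unset Printing Implicit Defensive.

Local Open Scope classical_set_scope.

Record adrel (A : Type) := ADRel {
  arity : nat;
  carrier : set (arity.-tuple A)
}.
Arguments carrier {A} a.

(* Stated on sequences so that no casts between tuple types of different
   lengths are needed. *)
Definition ad_mem (A : Type) (t : seq A) (R : adrel A) : Prop :=
  exists2 u : (arity R).-tuple A, carrier R u & tval u = t.

Definition ad_neg (A : Type) (R : adrel A) : adrel A :=
  ADRel [set t : (arity R).-tuple A | ~ carrier R t].

Definition ad_suffcap (A : Type) (R S : adrel A) : adrel A :=
  let m := maxn (arity R) (arity S) in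
  ADRel [set t : m.-tuple A | ad_mem (drop (m - arity R) t) R /\
                              ad_mem (drop (m - arity S) t) S].

Definition ad_ex (A : Type) (R : adrel A) : adrel A :=
  if arity R == 0 then R
  else ADRel [set t : (arity R).-1.-tuple A | exists a : A, ad_mem (rcons t a) R].

(* The vocabulary of a model is an arbitrary set of symbols taken from Sym,
   and only the symbols in it are interpreted. *)
Record model (Sym : Type) (ar : Sym -> nat) := Model {
  voc : set Sym;
  dom : Type;
  dom_nonempty : inhabited dom;
  interp : forall R : Sym, voc R -> set ((ar R).-tuple dom)
}.

Inductive term (Sym : Type) : Type :=
| TSym of Sym
| TNeg of term Sym
| TCap of term Sym & term Sym
| TEx of term Sym.

Fixpoint term_syms (Sym : Type) (T : term Sym) : set Sym :=
  match T with
  | TSym R => [set R]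
  | TNeg T1 => term_syms T1
  | TCap T1 T2 => term_syms T1 `|` term_syms T2
  | TEx T1 => term_syms T1
  end.

Fixpoint term_den (Sym : Type) (ar : Sym -> nat) (M : model ar)
    (T : term Sym) : term_syms T `<=` voc M -> adrel (dom M) :=
  match T return term_syms T `<=` voc M -> adrel (dom M) with
  | TSym R => fun h => ADRel (interp (h R erefl))
  | TNeg T1 => fun h => ad_neg (@term_den Sym ar M T1 h)
  | TCap T1 T2 => fun h =>
      ad_suffcap (@term_den Sym ar M T1 (fun R r => h R (or_introl r)))
                 (@term_den Sym ar M T2 (fun R r => h R (or_intror r)))
  | TEx T1 => fun h => ad_ex (@term_den Sym ar M T1 h)
  end.

(* First-order formulas; the number i stands for the variable v_(i+1). *)
Inductive formula (Sym : Type) (ar : Sym -> nat) : Type :=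
| FAtom (R : Sym) of (ar R).-tuple nat
| FNeg of formula ar
| FAnd of formula ar & formula ar
| FEx of nat & formula ar.

Fixpoint formula_syms (Sym : Type) (ar : Sym -> nat) (phi : formula ar) :
    set Sym :=
  match phi with
  | FAtom R _ => [set R]
  | FNeg p => formula_syms p
  | FAnd p q => formula_syms p `|` formula_syms q
  | FEx _ p => formula_syms p
  end.

Fixpoint free_occ (Sym : Type) (ar : Sym -> nat) (phi : formula ar) : seq nat :=
  match phi with
  | FAtom _ xs => xs
  | FNeg p => free_occ p
  | FAnd p q => free_occ p ++ free_occ q
  | FEx x p => [seq y <- free_occ p | y != x]
  end.

Definition free_vars (Sym : Type) (ar : Sym -> nat) (phi : formula ar) :
    seq nat :=
  sort leq (undup (free_occ phi)).

Fixpoint sat (Sym : Type) (ar : Sym -> nat) (M : model ar) (phi : formula ar) :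
    formula_syms phi `<=` voc M -> (nat -> dom M) -> Prop :=
  match phi return formula_syms phi `<=` voc M -> (nat -> dom M) -> Prop with
  | FAtom R xs => fun h e => interp (h R erefl) (map_tuple e xs)
  | FNeg p => fun h e => ~ @sat Sym ar M p h e
  | FAnd p q => fun h e =>
      @sat Sym ar M p (fun R r => h R (or_introl r)) e /\
      @sat Sym ar M q (fun R r => h R (or_intror r)) e
  | FEx x p => fun h e =>
      exists a : dom M, @sat Sym ar M p h [eta e with x |-> a]
  end.

(* Satisfaction depends only on the values of the free variables, and since
   the domain is nonempty every tuple is the restriction of an assignment. *)
Definition formula_den (Sym : Type) (ar : Sym -> nat) (M : model ar)
    (phi : formula ar) (h : formula_syms phi `<=` voc M) : adrel (dom M) :=
  ADRel [set t : (size (free_vars phi)).-tuple (dom M) |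
    exists2 e : nat -> dom M, map e (free_vars phi) = t & sat h e].

Inductive FLk (Sym : Type) (ar : Sym -> nat) : nat -> formula ar -> Prop :=
| FLk_atom k (R : Sym) (xs : (ar R).-tuple nat) :
    ar R <= k -> tval xs = iota (k - ar R) (ar R) -> FLk k (FAtom xs)
| FLk_neg k phi : FLk k phi -> FLk k (FNeg phi)
| FLk_and k phi psi : FLk k phi -> FLk k psi -> FLk k (FAnd phi psi)
| FLk_ex k phi : FLk k.+1 phi -> FLk k (FEx k phi).

Definition FL (Sym : Type) (ar : Sym -> nat) (phi : formula ar) : Prop :=
  exists k : nat, FLk k phi.

Definition equivalent (Sym : Type) (ar : Sym -> nat)
    (phi : formula ar) (T : term Sym) : Prop :=
  forall (M : model ar) (hphi : formula_syms phi `<=` voc M)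
         (hT : term_syms T `<=` voc M),
    formula_den hphi = term_den hT.

(* Main.v *)
From mathcomp Require Import all_boot.
From mathcomp Require Import boolp classical_sets zify.
Require Import Defs.

(** A formula of [FL^k] has as free variables the last [n] of [v_1, ..., v_k]
    for some [n <= k]: this is true of atoms, a conjunction takes the maximum
    of the two numbers, and [exists v_(k+1)] decreases the number by one unless
    it is already zero. These are the arity rules of the algebra, so replacing
    each connective by the operator with the same name preserves the defined
    relation. Every term of arity at most [k] is the image of a formula of
    [FL^k] under this replacement. *)

Set Implicit Arguments.
Unset Strict Implicit.
Unset Printing Implicit Defensive.

Local Open Scope classical_set_scope.

Section ADRelations.
Variable A : Type.
Implicit Types (R S : adrel A) (t : seq A).

Lemma ad_mem_size R t : ad_mem t R -> size t = arity R.
Proof. by case=> u _ <-; rewrite size_tuple. Qed.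

Lemma ad_mem_tval R (u : (arity R).-tuple A) : ad_mem u R <-> carrier R u.
Proof. by split=> [[v Rv /val_inj <-] //|Ru]; exists u. Qed.

(** Once the arities are identified, both carriers live over the same tuple type; membership of
    sequences avoids any cast before that. *)
Lemma adrel_ext R S :
  arity R = arity S -> (forall t, ad_mem t R <-> ad_mem t S) -> R = S.
Proof.
case: R S => [n C] [m D] /= enm; case: m / enm D => D CD; congr ADRel.
by apply/seteqP; split=> u /(ad_mem_tval (R := ADRel _)) /CD
  /(ad_mem_tval (R := ADRel _)).
Qed.

Lemma ad_mem_neg R t : ad_mem t (ad_neg R) <-> size t = arity R /\ ~ ad_mem t R.
Proof.
split=> [[u nRu <-]|[st nRt]].
  by split; [rewrite size_tuple | move/(ad_mem_tval (R := R) u)].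
have st' : size t == arity R by apply/eqP.
by exists (Tuple st') => //= Rt; apply: nRt; exists (Tuple st').
Qed.

Lemma ad_mem_suffcap R S t (m := maxn (arity R) (arity S)) :
  ad_mem t (ad_suffcap R S) <->
  [/\ size t = m, ad_mem (drop (m - arity R) t) R
    & ad_mem (drop (m - arity S) t) S].
Proof.
split=> [[u [Ru Su] <-]|[st Rt St]]; first by rewrite size_tuple.
have st' : size t == m by apply/eqP.
by exists (Tuple st').
Qed.

Lemma arity_ad_ex R : arity (ad_ex R) = (arity R).-1.
Proof. by rewrite /ad_ex; case: eqP => // ->. Qed.

Lemma ad_mem_ex0 R t : arity R = 0 -> ad_mem t (ad_ex R) <-> ad_mem t R.
Proof. by rewrite /ad_ex => ->. Qed.

Lemma ad_mem_exS R t :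
  0 < arity R -> ad_mem t (ad_ex R) <-> exists a, ad_mem (rcons t a) R.
Proof.
rewrite lt0n /ad_ex => /negPf ->.
split=> [[u Ru <-] //|[a Rta]].
have st : size t == (arity R).-1 by rewrite -(ad_mem_size Rta) size_rcons.
by exists (Tuple st) => //; exists a.
Qed.

End ADRelations.

Lemma sort_undup_iota s i n : s =i iota i n -> sort leq (undup s) = iota i n.
Proof.
move=> eq_s; apply: (sorted_eq leq_trans anti_leq).
- by apply: sort_sorted; apply: leq_total.
- exact: iota_sorted.
- rewrite perm_sort; apply: uniq_perm; rewrite ?undup_uniq ?iota_uniq //.
  by move=> x; rewrite mem_undup eq_s.
Qed.

Section Translation.
Variables (Sym : Type) (ar : Sym -> nat).
Implicit Types (phi : formula ar) (T : term Sym) (M : model ar).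

(** Variables can be forgotten: in [FLk k] they are determined by [k] and the arities. *)
Fixpoint term_of phi : term Sym :=
  match phi with
  | @FAtom _ _ R _ => TSym R
  | FNeg p => TNeg (term_of p)
  | FAnd p q => TCap (term_of p) (term_of q)
  | FEx _ p => TEx (term_of p)
  end.

(** The level [k] is also the index of the next variable to quantify. For [k] below the arity of [T]
    the subtraction truncates and the result need not be fluted. *)
Fixpoint formula_of k T : formula ar :=
  match T with
  | TSym R => FAtom (iota_tuple (ar R) (k - ar R))
  | TNeg T1 => FNeg (formula_of k T1)
  | TCap T1 T2 => FAnd (formula_of k T1) (formula_of k T2)
  | TEx T1 => FEx k (formula_of k.+1 T1)
  end.

(** A model-free arity, so that free variables can be described syntactically. *)
Fixpoint term_arity T : nat :=
  match T with
  | TSym R => ar R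
  | TNeg T1 => term_arity T1
  | TCap T1 T2 => maxn (term_arity T1) (term_arity T2)
  | TEx T1 => (term_arity T1).-1
  end.

Lemma formula_ofK k : cancel (formula_of k) term_of.
Proof.
by move=> T; elim: T k => //= [T IH|T1 IH1 T2 IH2|T IH] k;
  rewrite ?IH ?IH1 ?IH2.
Qed.

Lemma formula_of_FLk k T : term_arity T <= k -> FLk k (formula_of k T).
Proof.
elim: T k => /= [R|T IH|T1 IH1 T2 IH2|T IH] k.
- by move=> le_Rk; apply: FLk_atom.
- by move=> /IH; apply: FLk_neg.
- by rewrite geq_max => /andP[/IH1 ? /IH2 ?]; apply: FLk_and.
- by move=> le_Tk; apply/FLk_ex/IH; lia.
Qed.

Lemma arity_term_den M T (h : term_syms T `<=` voc M) :
  arity (term_den h) = term_arity T.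
Proof.
elim: T h => //= [T1 IH1 T2 IH2|T IH] h; first by rewrite IH1 IH2.
by rewrite arity_ad_ex IH.
Qed.

Definition fl_vars k phi :=
  iota (k - term_arity (term_of phi)) (term_arity (term_of phi)).

Lemma term_arity_FLk k phi : FLk k phi -> term_arity (term_of phi) <= k.
Proof.
elim=> {k phi} //= [k phi psi _ le1 _ le2|k phi _]; first by rewrite geq_max le1.
by case: term_arity.
Qed.

Lemma free_occ_FLk k phi : FLk k phi -> free_occ phi =i fl_vars k phi.
Proof.
rewrite /fl_vars; elim=> {k phi} //=
  [k R xs _ -> //|k p q Hp IHp Hq IHq x|k p Hp IHp x].
- have := term_arity_FLk Hp; have := term_arity_FLk Hq.
  rewrite mem_cat IHp IHq !mem_iota; lia.
- have := term_arity_FLk Hp.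
  rewrite mem_filter IHp !mem_iota; lia.
Qed.

Lemma free_vars_FLk k phi : FLk k phi -> free_vars phi = fl_vars k phi.
Proof. by move=> /free_occ_FLk; apply: sort_undup_iota. Qed.

Lemma sat_term_den k phi M (hphi : formula_syms phi `<=` voc M)
    (hT : term_syms (term_of phi) `<=` voc M) (e : nat -> dom M) :
  FLk k phi ->
  sat hphi e <-> ad_mem (map e (fl_vars k phi)) (term_den hT).
Proof.
rewrite /fl_vars => FLphi.
elim: FLphi hphi hT e => {k phi} /=
  [k R xs _ exs|k p Hp IHp|k p q Hp IHp Hq IHq|k p Hp IHp] hphi hT e.
(* [interp] takes a proof that the symbol is in the vocabulary, and the two sides carry different
   proofs. *)
- rewrite -exs (Prop_irrelevance (hT R erefl) (hphi R erefl)).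
  by rewrite (ad_mem_tval (R := ADRel _) (map_tuple e xs)).
- rewrite ad_mem_neg (IHp _ hT) size_map size_iota arity_term_den.
  by split=> [|[]].
- have le_pk := term_arity_FLk Hp; have le_qk := term_arity_FLk Hq.
  rewrite ad_mem_suffcap !arity_term_den size_map size_iota.
  rewrite -!map_drop !drop_iota.
  set m := maxn _ _.
  (* Dropping the first [m - n] of the last [m] variables leaves the last [n], so suffixes match the
     variables of each conjunct. *)
  have sufE n : n <= m -> k - m + (m - n) = k - n by lia.
  rewrite !sufE ?leq_maxl ?leq_maxr // !subKn ?leq_maxl ?leq_maxr //.
  rewrite (IHp _ (fun R r => hT R (or_introl r))).
  rewrite (IHq _ (fun R r => hT R (or_intror r))).
  by split=> [[]|[]].
- have le_pk := term_arity_FLk Hp.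
  have IH a := IHp hphi hT [eta e with k |-> a].
  (* At arity zero the quantifier is vacuous and [ad_ex] is the identity; a nonempty domain supplies
     the witness. *)
  have [p0|p_gt0] := posnP (term_arity (term_of p)).
    rewrite ad_mem_ex0 ?arity_term_den // p0 /=.
    rewrite p0 /= in IH.
    split=> [[a /IH //]|Te].
    by have [a] := dom_nonempty M; exists a; apply/IH.
  rewrite ad_mem_exS ?arity_term_den //.
  set n := term_arity _ in le_pk p_gt0 IH *.
  (* The quantified variable is the last one of the body, so updating it only changes the final
     entry, the one [ad_ex] projects away. *)
  have vars a : map [eta e with k |-> a] (iota (k.+1 - n) n) =
                rcons (map e (iota (k - n.-1) n.-1)) a.
    have -> : k.+1 - n = k - n.-1 by lia.
    have -> : iota (k - n.-1) n = rcons (iota (k - n.-1) n.-1) k.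
      rewrite -cats1 -[X in iota _ X = _](prednK p_gt0) -addn1 iotaD /=.
      by have -> : k - n.-1 + n.-1 = k by lia.
    rewrite map_rcons /= eqxx; congr rcons; apply/eq_in_map => x.
    by rewrite mem_iota => lt_xk /=; case: eqP => // ?; lia.
  split=> -[a Ha]; exists a; first by rewrite -vars; apply/IH.
  by apply/IH; rewrite vars.
Qed.

(** Supplies the assignment that [formula_den] asks for; nonemptiness gives the default value
    outside the interval. *)
Lemma map_iota_surj (A : Type) i (t : seq A) :
  inhabited A -> exists e : nat -> A, map e (iota i (size t)) = t.
Proof.
case=> a; exists (fun j => nth a t (j - i)).
rewrite -[i in iota i]addn0 iotaDl -map_comp -[RHS](mkseq_nth a).
by apply: eq_map => j /=; rewrite addKn.
Qed.

Lemma equivalent_term_of k phi : FLk k phi -> equivalent phi (term_of phi).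
Proof.
move=> FLphi M hphi hT; have fvE := free_vars_FLk FLphi.
apply: adrel_ext => [|t].
  by rewrite /= fvE size_iota arity_term_den.
split=> [[u [e eu sat_e] <-]|Tt].
  by rewrite -eu fvE; apply/(sat_term_den hphi).
have st : size t = term_arity (term_of phi).
  by rewrite (ad_mem_size Tt) arity_term_den.
have st' : size t == size (free_vars phi) by rewrite fvE size_iota st.
have [e et] := map_iota_surj (k - size t) t (dom_nonempty M).
have et' : map e (fl_vars k phi) = t by rewrite /fl_vars -st.
exists (Tuple st') => //; exists e; first by rewrite /= -[RHS]et' -fvE.
by apply/(sat_term_den _ hT _ FLphi); rewrite et'.
Qed.

End Translation.

Theorem proposition8p2 (Sym : Type) (ar : Sym -> nat) :
  (forall phi : formula ar, FL phi ->
     exists T : term Sym, equivalent phi T) /\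
  (forall T : term Sym,
     exists phi : formula ar, FL phi /\ equivalent phi T).
Proof.
split=> [phi [k FLphi]|T].
  by exists (term_of phi); apply: equivalent_term_of FLphi.
have FLphi := formula_of_FLk (leqnn (term_arity ar T)).
exists (formula_of ar (term_arity ar T) T); split; first by exists (term_arity ar T).
(* Translating the formula back returns [T] itself, so the first direction applies. *)
by have := equivalent_term_of FLphi; rewrite formula_ofK.
Qed.
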